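(* Let $d\ge1$, $\lambda>0$, $\delta>0$, and let $f:\mathbb{R}^d\to\mathbb{R}$ satisfy: (A1) $f$ is continuous and has at least one minimizer; (A2) $\int_{\mathbb{R}^d}\exp(-f(y)/\delta)\,dy<+\infty$; and let $f$ be $L$-smooth. Assume that for every $x\in\mathbb{R}^d$ the probability measure $\mu_x$ satisfies a Poincaré inequality with constant $C_P(\delta,x)<\infty$. Then for all $x\in\mathbb{R}^d$, \[\|\nabla f^{\lambda,\delta}(x)-\nabla f(x)\|\le L\lambda\|\nabla f^{\lambda,\delta}(x)\|+L\sqrt{d\,C_P(\delta,x)}.\] In particular, the ZOPPA sequence $(x^k)$ satisfies $\|\nabla f(x^k)\|\le(1+L\lambda)\|\nabla f^{\lambda,\delta}(x^k)\|+L\sqrt{d\,C_P(\delta,x^k)}$ for all $k$.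
   Context: $\mu_x$ is the probability measure on $\mathbb{R}^d$ with density proportional to $\exp\big(-\frac{1}{\delta}(f(y)+\frac{1}{2\lambda}\|x-y\|^2)\big)$. A probability measure $\mu$ satisfies a Poincaré inequality with constant $C_P>0$ if $\int|g-\int g\,d\mu|^2d\mu\le C_P\int\|\nabla g\|^2d\mu$ for every smooth, suitably integrable $g$. The soft Moreau envelope is $f^{\lambda,\delta}(x)=-\delta\log\mathbb{E}_{y\sim\mathcal N(x,\lambda\delta I)}[\exp(-f(y)/\delta)]$; the zeroth-order proximal operator is $\operatorname{zprox}^\delta_{\lambda,f}(x)=\dfrac{\mathbb{E}_{y\sim\mathcal N(x,\lambda\delta I)}[y\exp(-f(y)/\delta)]}{\mathbb{E}_{y\sim\mathcal N(x,\lambda\delta I)}[\exp(-f(y)/\delta)]}$. ZOPPA: $x^{k+1}=\operatorname{zprox}^\delta_{\lambda,f}(x^k)$ from any $x^0$. $L$-smooth means differentiable with $L$-Lipschitz gradient. *)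

(* Defs.v *)
From HB Require Import structures.
From mathcomp Require Import all_boot all_order all_algebra.
From mathcomp Require Import all_classical all_reals all_analysis.
Set Implicit Arguments. Unset Strict Implicit. Unset Printing Implicit Defensive.
Import Order.TTheory GRing.Theory Num.Theory.
Import numFieldNormedType.Exports.
Local Open Scope classical_set_scope.
Local Open Scope ring_scope.

(* R^d is modelled as row vectors 'rV[R]_d.  We equip it with the      *)
(* Borel (= product) sigma-algebra generated by the coordinate maps,  *)
(* exactly as the library does for n.-tuple T.                        *)
Definition rV_measure_display : measure_display -> measure_display.
Proof. exact. Qed.

Section measurable_rV.
Context {R : realType} (n : nat).

Let coord : 'I_n -> 'rV[R]_n -> R := fun i x => x ord0 i.

Let rV_set0 : g_sigma_preimage coord set0.
Proof. exact: sigma_algebra0. Qed.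

Let rV_setC A : g_sigma_preimage coord A -> g_sigma_preimage coord (~` A).
Proof. exact: sigma_algebraC. Qed.

Let rV_bigcup (F : _^nat) : (forall i, g_sigma_preimage coord (F i)) ->
  g_sigma_preimage coord (\bigcup_i (F i)).
Proof. exact: sigma_algebra_bigcup. Qed.

HB.instance Definition _ := @isMeasurable.Build
  (rV_measure_display default_measure_display)
  'rV[R]_n (g_sigma_preimage coord) rV_set0 rV_setC rV_bigcup.
End measurable_rV.

Section defs.
Context {R : realType} {d : nat}.
Implicit Types (x y : 'rV[R]_d) (f g : 'rV[R]_d -> R).

(* Lebesgue measure on R^d: the measure of every half-open box
   prod_i [a_i, b_i) is the product of the side lengths (this determines
   the measure uniquely on the Borel sigma-algebra). *)
Definition is_lebesgue_measure (mu : {measure set 'rV[R]_d -> \bar R}) :=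
  forall a b : 'rV[R]_d, (forall i, a ord0 i <= b ord0 i) ->
    mu [set x | forall i, a ord0 i <= x ord0 i < b ord0 i] =
    (\prod_(i < d) (b ord0 i - a ord0 i))%:E.

Definition enorm x : R := Num.sqrt (\sum_(i < d) x ord0 i ^+ 2).

Definition grad f x : 'rV[R]_d := \row_(i < d) derive f x (delta_mx ord0 i).

Definition L_smooth (L : R) f :=
  (forall x, differentiable f x) /\
  (forall x y, enorm (grad f x - grad f y) <= L * enorm (x - y)).

Fixpoint iter_derive (vs : seq 'rV[R]_d) f : 'rV[R]_d -> R :=
  match vs with
  | [::] => f
  | v :: vs' => fun x => derive (iter_derive vs' f) x v
  end.
Definition smooth f := forall (vs : seq 'rV[R]_d) x,
  differentiable (iter_derive vs f) x.

Definition gauss_density (s : R) x y : R :=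
  (2 * pi * s) `^ (- (d%:R / 2)) * expR (- (enorm (y - x) ^+ 2) / (2 * s)).

Variable mu : {measure set 'rV[R]_d -> \bar R}.

Definition gauss_expect (lam del : R) x (h : 'rV[R]_d -> R) : R :=
  Rintegral mu setT (fun y => gauss_density (lam * del) x y * h y).

Definition soft_moreau (lam del : R) f x : R :=
  - del * ln (gauss_expect lam del x (fun y => expR (- f y / del))).

Definition zprox (lam del : R) f x : 'rV[R]_d :=
  \row_(i < d) (gauss_expect lam del x (fun y => y ord0 i * expR (- f y / del))
                / gauss_expect lam del x (fun y => expR (- f y / del))).

Definition mux_weight (lam del : R) f x y : R :=
  expR (- (f y + enorm (x - y) ^+ 2 / (2 * lam)) / del).
Definition mux_density (lam del : R) f x y : R :=
  mux_weight lam del f x y / Rintegral mu setT (mux_weight lam del f x).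

Definition mux_int (lam del : R) f x (h : 'rV[R]_d -> R) : R :=
  Rintegral mu setT (fun y => mux_density lam del f x y * h y).

Definition mux_poincare (lam del : R) f x (C : R) :=
  0 < C /\
  forall g, smooth g ->
    mu.-integrable setT (fun y => (mux_density lam del f x y * g y ^+ 2)%:E) ->
    mu.-integrable setT
      (fun y => (mux_density lam del f x y * enorm (grad g y) ^+ 2)%:E) ->
    mux_int lam del f x (fun y => (g y - mux_int lam del f x g) ^+ 2)
    <= C * mux_int lam del f x (fun y => enorm (grad g y) ^+ 2).

End defs.

(* Main.v *)
Require Import Defs.
From HB Require Import structures.
From mathcomp Require Import all_boot all_order all_algebra.
From mathcomp Require Import all_classical all_reals all_analysis.
From mathcomp Require Import measurable_realfun ring lra.
Import Order.TTheory GRing.Theory Num.Theory.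
Import numFieldNormedType.Exports.
Local Open Scope classical_set_scope.
Local Open Scope ring_scope.

(* Write [E] for the expectation under mu_x and [m = E y].  Differentiating the
   Gaussian in x gives [lam * grad (soft_moreau f) x = x - m], while integrating
   by parts in y gives [lam * E (grad f y) = x - m], so that
   [grad (soft_moreau f) x - grad f x = E (grad f y - grad f x)].  By Jensen and
   Lipschitz continuity its squared norm is at most
   [L^2 E |x - y|^2 = L^2 (|x - m|^2 + sum_i Var y_i)], and Poincare's inequality
   for the coordinate functions bounds each variance by [CP x].

   No dominated convergence is needed: both derivatives come from a
   second-order Taylor bound on the weight whose remainder is at most
   [K |h|^2 exp (- f y / del)], the Gaussian factor absorbing all polynomial
   and exponential growth.  In particular, integration by parts is the
   translation invariance of Lebesgue measure combined with this bound. *)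

(** * Lebesgue measure on row vectors *)

Section measurability.
Context {R : realType} {d : nat}.
Implicit Types (x y v : 'rV[R]_d).

Lemma measurable_rV_coord (i : 'I_d) :
  measurable_fun [set: 'rV[R]_d] (fun x => x ord0 i).
Proof.
move=> _ Y mY; rewrite setTI; apply: sub_sigma_algebra => /=.
rewrite -bigcup_seq/=; exists i => /=; first by rewrite mem_index_enum.
by exists Y => //; rewrite setTI.
Qed.

Lemma measurable_fun_rV d' (T : measurableType d') (g : T -> 'rV[R]_d) :
  (forall i, measurable_fun setT (fun t => g t ord0 i)) ->
  measurable_fun setT g.
Proof.
move=> mg; apply: (@measurability _ _ _ _ _ _
  (\big[setU/set0]_(i < d) preimage_set_system setT
     (fun x : 'rV[R]_d => x ord0 i) measurable)) => // _ [B + <-].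
rewrite -bigcup_seq => -[i _ [C mC <-]].
by rewrite setTI; exact: mg.
Qed.

Lemma rV_norm_coord_le x (i : 'I_d) : `|x ord0 i| <= `|x|.
Proof.
rewrite [leRHS]/Num.Def.normr /= mx_normrE.
exact: (le_bigmax _ (fun ij => `|x ij.1 ij.2|) (ord0, i)).
Qed.

(** The sigma-algebra is generated by the coordinates, not by the open sets, so an open preimage is
    written as a countable union of rational cubes, which are measurable as finite intersections of
    coordinate slabs. *)
Lemma continuous_measurable_rV (f : 'rV[R]_d -> R) :
  continuous f -> measurable_fun setT f.
Proof.
move=> cf; apply: (measurability _ (RGenOInfty.measurableE R)) => _ [_ [r ->] <-].
rewrite setTI; set U := _ @^-1` _.
have oU : open U by apply: open_comp => //; exact: rray_open.
(* The open cube with rational centre [p.1] and half-side [1 / (p.2 + 1)]; the index type is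
   countable. *)
pose B (p : 'rV[rat]_d * nat) :=
  [set y : 'rV[R]_d | forall i, `|y ord0 i - ratr (p.1 ord0 i)| < p.2.+1%:R^-1].
have mB p : measurable (B p).
  have -> : B p = \bigcap_(i in [set: 'I_d])
     ((fun y : 'rV[R]_d => y ord0 i) @^-1`
        [set z | `|z - ratr (p.1 ord0 i)| < p.2.+1%:R^-1]).
    by apply/seteqP; split => y /= By i; [move=> _; exact: By|exact: (By i)].
  apply: fin_bigcap_measurable => // i _; rewrite -[X in measurable X]setTI.
  apply: measurable_rV_coord => //.
  have -> : [set z : R | `|z - ratr (p.1 ord0 i)| < p.2.+1%:R^-1] =
            ball (ratr (p.1 ord0 i) : R) p.2.+1%:R^-1.
    by apply/seteqP; split => z; rewrite -ball_normE /= distrC.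
  exact: measurable_ball.
have -> : U = \bigcup_p (if pselect (B p `<=` U) then B p else set0).
  apply/seteqP; split => [x Ux|x [p _]]; last by case: pselect => // BU /BU.
  have /nbhs_ballP[e /= e0 xeU] := oU _ Ux.
  (* Every point of a cube with this half-side is within [e / 2] of the centre in each coordinate,
     so a cube that contains [x] lies in the sup-norm ball of radius [e] around [x]. *)
  have [k ke] : exists k : nat, k.+1%:R^-1 < e / 2.
    have e2 : 0 < (e / 2)^-1 by rewrite invr_gt0 divr_gt0.
    exists (Num.truncn (e / 2)^-1); rewrite invf_plt ?posrE ?divr_gt0//.
    exact: truncnS_gt.
  have /choice[q qx] : forall i : 'I_d, exists z : rat,
      `|x ord0 i - ratr z| < k.+1%:R^-1.
    move=> i.
    have : x ord0 i - k.+1%:R^-1 < x ord0 i + k.+1%:R^-1.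
      by rewrite ltrBlDr -addrA ltrDl addr_gt0.
    move=> /rat_in_itvoo[z]; rewrite in_itv/= => /andP[z1 z2]; exists z.
    by rewrite ltr_distlC z1.
  exists (\row_i q i, k) => //.
  case: pselect => [_ i|nBU]; first by rewrite mxE; exact: qx.
  exfalso; apply: nBU => y By; apply: xeU; rewrite /ball/=; split => // i0 i.
  rewrite !ord1 /ball/=.
  have := By i; rewrite mxE distrC => yq.
  rewrite (le_lt_trans (ler_distD (ratr (q i)) _ _))//.
  rewrite (splitr e); apply: ltrD; [exact: lt_trans (qx i) ke|exact: lt_trans yq ke].
apply: countable_bigcupT_measurable => [|p]; last first.
  by case: (pselect _) => ?; [exact: mB|exact: measurable0].
exact: countableP.
Qed.

Definition box (a b : 'rV[R]_d) :=
  [set x : 'rV[R]_d | forall i, a ord0 i <= x ord0 i < b ord0 i].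

(** Half-open boxes are the sets on which [is_lebesgue_measure] prescribes the value; being a
    generating pi-system, they determine the measure. *)
Lemma measurable_rV_box :
  measurable = <<s [set A | exists a b : 'rV[R]_d, A = box a b] >>.
Proof.
set G := [set A | _]; apply/seteqP; split; last first.
  apply: smallest_sub; first exact: sigma_algebra_measurable.
  move=> _ [a [b ->]].
  have -> : box a b = \bigcap_(i in [set: 'I_d])
     ((fun y : 'rV[R]_d => y ord0 i) @^-1` `[a ord0 i, b ord0 i[%classic).
    apply/seteqP; split => y /= By i; first by move=> _; rewrite /= in_itv/= By.
    by have := By i I; rewrite /= in_itv.
  apply: fin_bigcap_measurable => // i _; rewrite -[X in measurable X]setTI.
  exact: measurable_rV_coord.
apply: smallest_sub; first exact: smallest_sigma_algebra.
move=> A; rewrite -bigcup_seq => -[i _ [C mC <-]].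
suff : measurable_fun [set: g_sigma_algebraType G]
   (fun y : g_sigma_algebraType G => (y : 'rV[R]_d) ord0 i) by exact.
apply: (measurability _ (RGenCInfty.measurableE R)) => _ [_ [r ->] <-].
rewrite setTI.
(* The half-space [x_i >= r] is the union of these boxes: side [[r, k)] in direction [i] and
   [[-k, k)] in the others. *)
pose F (k : nat) := box (\row_j if j == i then r else - k%:R) (const_mx k%:R).
have -> : (fun y : g_sigma_algebraType G => (y : 'rV[R]_d) ord0 i) @^-1`
    `[r, +oo[%classic = \bigcup_k F k.
  apply/seteqP; split => [x /=|x [k _] /= /(_ i)]; last first.
    by rewrite !mxE eqxx in_itv/= andbT => /andP[].
  rewrite in_itv/= andbT => rx.
  exists (Num.truncn `|x : 'rV[R]_d|).+1 => // j; rewrite !mxE.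
  have := le_lt_trans (rV_norm_coord_le x j) (truncnS_gt _).
  rewrite ltr_norml => /andP[/ltW xj ->].
  by case: eqP => [->|_]; rewrite andbT.
apply: bigcupT_measurable => k; apply: sub_sigma_algebra.
by eexists; eexists; reflexivity.
Qed.

Lemma box_setI_closed :
  setI_closed [set A | exists a b : 'rV[R]_d, A = box a b].
Proof.
move=> _ _ [a [b ->]] [a' [b' ->]].
exists (\row_i Num.max (a ord0 i) (a' ord0 i)),
  (\row_i Num.min (b ord0 i) (b' ord0 i)).
apply/seteqP; split => [x [xab xab'] i|x xI].
  rewrite !mxE ge_max lt_min.
  by have /andP[-> ->] := xab i; have /andP[-> ->] := xab' i.
by split => i; have := xI i; rewrite !mxE ge_max lt_min => /andP[/andP[? ?] /andP[? ?]];
  apply/andP.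
Qed.

Lemma measurable_shift v : measurable_fun setT (fun y : 'rV[R]_d => y + v).
Proof.
apply: measurable_fun_rV => i.
under eq_fun do rewrite mxE.
by apply: measurable_funD => //; exact: measurable_rV_coord.
Qed.

(** Uniqueness of measures: translation sends boxes to boxes with the same side lengths, and the
    boxes [[-k, k)^d] exhaust the space with finite measure. *)
Lemma lebesgue_shift (mu : {measure set 'rV[R]_d -> \bar R}) v :
  is_lebesgue_measure mu -> forall A, measurable A ->
  mu A = pushforward mu (fun y => y + v) A.
Proof.
move=> muL.
have preim a b : (fun y => y + v) @^-1` box a b = box (a - v) (b - v).
  apply/seteqP; split => x /= xB i; have := xB i;
  by rewrite !mxE lerBlDr ltrBrDr.
apply: (measure_unique [set A | exists a b : 'rV[R]_d, A = box a b]
  (fun k : nat => box (const_mx (- k%:R)) (const_mx k%:R)) _ _ _ _ mu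
  (pushforward mu (fun y => y + v))).
- exact: measurable_rV_box.
- exact: box_setI_closed.
- by move=> k; eexists; eexists; reflexivity.
- rewrite -subTset => x _; exists (Num.truncn `|x : 'rV[R]_d|).+1 => // j; rewrite !mxE.
  have := le_lt_trans (rV_norm_coord_le x j) (truncnS_gt _).
  by rewrite ltr_norml => /andP[/ltW -> ->].
- exact: measurable_shift.
- move=> m _ [a [b ->]]; transitivity (mu (box (a - v) (b - v))); last by rewrite -preim.
  (* The product formula is available only for ordered corners; otherwise the box and its translate
     are both empty. *)
  have [ab|/existsNP[i /negP]] := pselect (forall i, a ord0 i <= b ord0 i).
    rewrite !muL//; last by move=> i; rewrite !mxE lerB.
    by congr EFin; apply: eq_bigr => i _; rewrite !mxE; ring.
  rewrite -ltNge => bai.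
  have box0 (a' b' : 'rV[R]_d) : b' ord0 i < a' ord0 i -> box a' b' = set0.
    move=> ba; rewrite -subset0 => x /(_ i)/andP[ax xb].
    by have := lt_trans (le_lt_trans ax xb) ba; rewrite ltxx.
  by rewrite !box0// !mxE ltrD2r.
- move=> k; rewrite muL ?ltry// => i; rewrite !mxE.
  by rewrite (le_trans _ (ler0n _ k))// oppr_le0.
Qed.

Lemma lebesgue_integral_shift (mu : {measure set 'rV[R]_d -> \bar R}) v
    (g : 'rV[R]_d -> \bar R) :
  is_lebesgue_measure mu -> measurable_fun setT g -> (forall y, 0 <= g y)%E ->
  (\int[mu]_y g (y + v)%R = \int[mu]_y g y)%E.
Proof.
move=> muL mg g0.
transitivity (\int[pushforward mu (fun y => y + v)%R]_y g y)%E.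
  by rewrite (ge0_integral_pushforward (measurable_shift v)).
apply: (@eq_measure_integral _ _ _ _ mu (pushforward mu (fun y => y + v))).
  exact: measurable_shift.
by move=> m A mA _; exact/esym/lebesgue_shift.
Qed.

End measurability.

(** * Euclidean norm, Gaussian bounds and calculus *)

Section euclidean_norm.
Context {R : realType} {d : nat}.
Implicit Types (x y h : 'rV[R]_d).

Lemma enorm_ge0 x : 0 <= enorm x. Proof. exact: sqrtr_ge0. Qed.

Lemma sqr_enorm x : enorm x ^+ 2 = \sum_(i < d) x ord0 i ^+ 2.
Proof. by rewrite sqr_sqrtr// sumr_ge0// => i _; exact: sqr_ge0. Qed.

Lemma enormN x : enorm (- x) = enorm x.
Proof. by congr Num.sqrt; apply: eq_bigr => i _; rewrite mxE sqrrN. Qed.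

Lemma enormZ (c : R) x : enorm (c *: x) = `|c| * enorm x.
Proof.
rewrite -sqrtr_sqr -sqrtrM ?sqr_ge0//; congr Num.sqrt.
by rewrite mulr_sumr; apply: eq_bigr => i _; rewrite mxE exprMn.
Qed.

Lemma enorm_delta (i : 'I_d) : enorm (delta_mx ord0 i : 'rV[R]_d) = 1.
Proof.
rewrite /enorm (bigD1 i)//= big1 => [|j ji]; rewrite !mxE ?eqxx/=.
  by rewrite addr0 expr1n sqrtr1.
by rewrite (negbTE ji) expr0n.
Qed.

Lemma enorm_coord_le x (i : 'I_d) : `|x ord0 i| <= enorm x.
Proof.
rewrite -sqrtr_sqr ler_sqrt; last by rewrite sumr_ge0// => j _; exact: sqr_ge0.
by rewrite (bigD1 i)//= lerDl sumr_ge0// => j _; exact: sqr_ge0.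
Qed.

Lemma enorm_cauchy_schwarz x y :
  `|\sum_(i < d) x ord0 i * y ord0 i| <= enorm x * enorm y.
Proof.
set C := \sum_(i < d) _.
rewrite -sqrtr_sqr -sqrtrM; last by rewrite sumr_ge0// => j _; exact: sqr_ge0.
rewrite ler_sqrt; last first.
  by rewrite mulr_ge0// sumr_ge0// => j _; exact: sqr_ge0.
set A := \sum_(i < d) x ord0 i ^+ 2; set B := \sum_(i < d) _.
have B0 : 0 <= B by rewrite sumr_ge0// => j _; exact: sqr_ge0.
(* With [A = |x|^2], [B = |y|^2] and [C] the inner product, this sum equals [B (A B - C^2)], so one
   may divide by [B] unless [y = 0]. *)
have : 0 <= \sum_(i < d) (B * x ord0 i - C * y ord0 i) ^+ 2.
  by rewrite sumr_ge0// => j _; exact: sqr_ge0.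
have -> : \sum_(i < d) (B * x ord0 i - C * y ord0 i) ^+ 2 = B * (A * B - C ^+ 2).
  transitivity (\sum_(i < d) (B ^+ 2 * x ord0 i ^+ 2
      - 2 * B * C * (x ord0 i * y ord0 i) + C ^+ 2 * y ord0 i ^+ 2)).
    by apply: eq_bigr => i _; ring.
  by rewrite big_split sumrB/= -!mulr_sumr -/A -/B -/C; ring.
move: B0; rewrite le_eqVlt => /predU1P[B0 _|B0]; last by rewrite pmulr_rge0// subr_ge0.
have y0 i : y ord0 i = 0.
  apply/eqP; rewrite -sqrf_eq0; apply/eqP.
  apply: (psumr_eq0P (P := xpredT) (fun i _ => sqr_ge0 (y ord0 i))) => //.
by rewrite /C big1 ?expr0n/= -?B0 ?mulr0// => i _; rewrite y0 mulr0.
Qed.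

Lemma sqr_enormD x y : enorm (x + y) ^+ 2 =
  enorm x ^+ 2 + 2 * \sum_(i < d) x ord0 i * y ord0 i + enorm y ^+ 2.
Proof.
rewrite !sqr_enorm mulr_sumr -!big_split/=; apply: eq_bigr => i _.
rewrite mxE; ring.
Qed.

Lemma ler_enormD x y : enorm (x + y) <= enorm x + enorm y.
Proof.
rewrite -(@ler_pXn2r _ 2)// ?nnegrE ?addr_ge0 ?enorm_ge0//.
rewrite sqr_enormD.
have := le_trans (ler_norm _) (enorm_cauchy_schwarz x y); lra.
Qed.

(** Bridge between the Euclidean norm of the statement and the sup norm that defines the topology
    and differentiability on row vectors. *)
Lemma enorm_le_norm x : enorm x ^+ 2 <= d%:R * `|x| ^+ 2.
Proof.
rewrite sqr_enorm (le_trans (ler_sum _ (G := fun=> `|x| ^+ 2) _))//.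
  move=> i _; rewrite -real_normK ?num_real// ler_pXn2r ?nnegrE//.
  exact: rV_norm_coord_le.
by rewrite sumr_const card_ord mulr_natl.
Qed.

Lemma continuous_sqr_enorm : continuous (fun x => enorm x ^+ 2).
Proof.
have -> : (fun x => enorm x ^+ 2) = (fun x => \sum_(i < d) x ord0 i ^+ 2).
  by apply/funext => x; rewrite sqr_enorm.
apply: continuous_big => [|i _ x]; first exact: add_continuous.
by apply: (@continuousM _ _ (fun y : 'rV[R]_d => y ord0 i)
  (fun y : 'rV[R]_d => y ord0 i)); exact: coord_continuous.
Qed.

Lemma continuous_enorm : continuous (@enorm R d).
Proof.
move=> x; have -> : @enorm R d = fun x => Num.sqrt (enorm x ^+ 2).
  by apply/funext => y; rewrite sqrtr_sqr ger0_norm ?enorm_ge0.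
apply: (@continuous_comp _ _ _ (fun x : 'rV[R]_d => enorm x ^+ 2) Num.sqrt).
  exact: continuous_sqr_enorm.
exact: sqrt_continuous.
Qed.

End euclidean_norm.

(** * Gaussian factors absorbing polynomial and exponential growth *)

Section gaussian_bounds.
Context {R : realType}.
Implicit Types (t p u c s eta : R).

(** From [exp t (1 - t) <= exp t exp (-t) = 1] the remainder is at most [t (exp t - 1)]. For
    [t >= 0] the same inequality gives [exp t - 1 <= t exp t]; for [t < 0], [exp t - 1 >= t] gives
    the bound [t^2]. *)
Lemma expR_taylor1 t : `|expR t - 1 - t| <= t ^+ 2 * expR `|t|.
Proof.
have e1 := expR_ge1Dx t.
have e2 : expR t - 1 - t <= t * (expR t - 1).
  have : expR t * (1 - t) <= 1.
    rewrite -[leRHS](@expRxMexpNx_1 _ t) ler_pM2l ?expR_gt0//.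
    exact: expR_ge1Dx.
  lra.
rewrite ger0_norm; last by lra.
apply: (le_trans e2); have [t0|t0] := leP 0 t.
  rewrite expr2 -mulrA ler_wpM2l//.
  have : expR t * (1 - t) <= 1.
    rewrite -[leRHS](@expRxMexpNx_1 _ t) ler_pM2l ?expR_gt0//.
    exact: expR_ge1Dx.
  rewrite ger0_norm//; lra.
apply: (@le_trans _ _ (t ^+ 2)).
  by rewrite expr2 (ler_wnM2l (ltW t0))//; lra.
by rewrite ler_peMr ?sqr_ge0// -expR0 ler_expR.
Qed.

Lemma sqr_le_expR t : 0 <= t -> t ^+ 2 <= 4 * expR t.
Proof.
move=> t0; have : t / 2 <= expR (t / 2).
  by apply: le_trans (expR_ge1Dx _); rewrite lerDr.
have -> : expR t = expR (t / 2) * expR (t / 2) by rewrite -expRD -splitr.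
move=> h; have h0 : 0 <= t / 2 by lra.
have := ler_pM h0 h0 h h; lra.
Qed.

(** With [z = c (1 + u)], [z^2 exp z <= 4 exp (2 z)]; completing the square in the exponent
    [- u^2 / (2 s) + 2 c u], whose maximum is at [u = 2 s c], yields the constant. *)
Lemma gauss_exp_bound s c u : 0 < s -> 0 <= c -> 0 <= u ->
  expR (- u ^+ 2 / (2 * s)) * ((c * (1 + u)) ^+ 2 * expR (c * (1 + u)))
  <= 4 * expR (2 * c + 2 * s * c ^+ 2).
Proof.
move=> s0 c0 u0; set z := c * (1 + u).
have z0 : 0 <= z by rewrite mulr_ge0// addr_ge0.
rewrite (@le_trans _ _ (expR (- u ^+ 2 / (2 * s)) * (4 * expR z * expR z)))//.
  by rewrite ler_wpM2l ?expR_ge0// ler_wpM2r ?expR_ge0// sqr_le_expR.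
have -> : expR (- u ^+ 2 / (2 * s)) * (4 * expR z * expR z) =
    4 * expR (- u ^+ 2 / (2 * s) + (z + z)) by rewrite !expRD; ring.
rewrite ler_wpM2l// ler_expR /z.
have -> : 2 * c + 2 * s * c ^+ 2 =
    - u ^+ 2 / (2 * s) + (c * (1 + u) + c * (1 + u)) + (u - 2 * s * c) ^+ 2 / (2 * s).
  by field; lra.
by rewrite lerDl divr_ge0 ?sqr_ge0// mulr_ge0// ltW.
Qed.

(** Split [exp t - 1 + p] as [(exp t - 1 - t) + (t + p)]. The first part is at most [t^2 exp |t|],
    from which [eta^2] is factored while [eta <= 1] keeps the exponential uniform in [eta]; it gives
    the constant with [4], the second part the summand [c]. *)
Lemma gauss_taylor_bound s c u eta t p :
  0 < s -> 0 <= c -> 0 <= u -> 0 <= eta <= 1 ->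
  `|t| <= c * eta * (1 + u) -> `|t + p| <= c * eta ^+ 2 ->
  expR (- u ^+ 2 / (2 * s)) * `|expR t - 1 + p|
  <= (4 * expR (2 * c + 2 * s * c ^+ 2) + c) * eta ^+ 2.
Proof.
move=> s0 c0 u0 /andP[eta0 eta1] tc tpc.
have cu0 : 0 <= c * (1 + u) by rewrite mulr_ge0// addr_ge0.
have tc1 : `|t| <= c * (1 + u).
  apply: (le_trans tc); rewrite mulrAC ler_piMr//.
have G1 : expR (- u ^+ 2 / (2 * s)) <= 1.
  rewrite -expR0 ler_expR mulNr oppr_le0 divr_ge0 ?sqr_ge0// mulr_ge0// ltW//.
have -> : expR t - 1 + p = (expR t - 1 - t) + (t + p) by ring.
have h1 : `|expR t - 1 - t| <= eta ^+ 2 * ((c * (1 + u)) ^+ 2 * expR (c * (1 + u))).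
  apply: (le_trans (expR_taylor1 t)); rewrite mulrA -exprMn.
  rewrite ler_pM ?sqr_ge0 ?expR_ge0 ?ler_expR//.
  rewrite -real_normK ?num_real// ler_pXn2r ?nnegrE ?mulr_ge0 ?addr_ge0//.
  by rewrite mulrA [eta * c]mulrC.
apply: (@le_trans _ _ (expR (- u ^+ 2 / (2 * s)) *
  (eta ^+ 2 * ((c * (1 + u)) ^+ 2 * expR (c * (1 + u))) + c * eta ^+ 2))).
  by rewrite ler_wpM2l ?expR_ge0// (le_trans (ler_normD _ _))// lerD.
rewrite [leLHS]mulrDr [leRHS]mulrDl lerD//.
  by rewrite mulrCA mulrC ler_wpM2r ?sqr_ge0// gauss_exp_bound.
by rewrite ler_piMl// mulr_ge0// sqr_ge0.
Qed.

Lemma gauss_quad_bound s u : 0 < s -> 0 <= u ->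
  expR (- u ^+ 2 / (2 * s)) * (1 + u) ^+ 2 <= 4 * expR (2 + 2 * s).
Proof.
move=> s0 u0; have := @gauss_exp_bound s 1 u s0 ler01 u0.
rewrite mulr1 mul1r expr1n mulr1; apply: le_trans.
rewrite ler_wpM2l ?expR_ge0// ler_peMr ?sqr_ge0//.
by rewrite -expR0 ler_expR addr_ge0.
Qed.

End gaussian_bounds.

(** * Gradients, Taylor bounds and coordinate functions *)

Section calculus.
Context {R : realType} {d : nat}.
Implicit Types (x y h v a : 'rV[R]_d).

Lemma quadratic_remainder_differentiable (g : 'rV[R]_d -> R) x a (K : R) :
  (forall h, enorm h <= 1 ->
     `|g (h + x) - g x - \sum_(i < d) h ord0 i * a ord0 i| <= K * enorm h ^+ 2) ->
  differentiable g x /\ grad g x = a.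
Proof.
move=> gK.
pose l h := \sum_(i < d) h ord0 i * a ord0 i.
have l_lin : linear l.
  move=> k u v; rewrite /l scaler_sumr -big_split/=; apply: eq_bigr => i _.
  by rewrite !mxE mulrDl -mulrA.
pose lM := GRing.isLinear.Build _ _ _ _ _ l_lin.
pose lL : {linear 'rV[R]_d -> R} := HB.pack l lM.
have l_cont : continuous lL.
  apply: continuous_big => [|i _ h]; first exact: add_continuous.
  apply: (@continuousM _ _ (fun y : 'rV[R]_d => y ord0 i) (cst (a ord0 i))).
    exact: coord_continuous.
  exact: cst_continuous.
have gE (e : R) : 0 < e ->
    \forall h \near (0 : 'rV[R]_d), `|g (h + x) - (g x + l h)| <= e * `|h|.
  (* In the sup norm the remainder is at most [K1 |h|^2], hence at most [e |h|] once
     [|h| <= e / K1]; the added 1 keeps [K1] positive. *)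
  move=> e0; pose K1 := `|K| * d%:R + 1.
  have K10 : 0 < K1 by rewrite ltr_wpDl// mulr_ge0.
  near=> h.
  have hd : enorm h ^+ 2 <= d%:R * `|h| ^+ 2 by exact: enorm_le_norm.
  have hK : `|h| <= e / K1.
    by near: h; apply: (@nbhs0_le R 'rV[R]_d); rewrite divr_gt0.
  (* Small enough in the sup norm that [enorm h <= 1], where the assumed bound holds. *)
  have h1 : `|h| <= d.+1%:R^-1 by near: h; apply: (@nbhs0_le R 'rV[R]_d).
  have h2 : d.+1%:R * `|h| <= 1 by rewrite -ler_pdivlMl// mulr1.
  have h0 := normr_ge0 h.
  have dh : d%:R * `|h| <= 1.
    by apply: le_trans h2; rewrite ler_wpM2r// ler_nat.
  have h3 : `|h| <= 1 by apply: le_trans h2; rewrite ler_peMl// ler1n.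
  have e1 : enorm h <= 1.
    rewrite -(@ler_pXn2r _ 2)// ?nnegrE ?enorm_ge0// expr1n (le_trans hd)//.
    by rewrite expr2 mulrA mulr_ile1// mulr_ge0.
  rewrite opprD addrA (le_trans (gK _ e1))//.
  apply: (@le_trans _ _ (`|K| * (d%:R * `|h| ^+ 2))).
    rewrite (le_trans (ler_wpM2r (sqr_ge0 _) (ler_norm K)))//.
    by rewrite ler_wpM2l.
  have : K1 * `|h| <= e by rewrite -ler_pdivlMl// mulrC.
  move=> /(ler_wpM2r h0); apply: le_trans.
  rewrite mulrA expr2 mulrA ler_wpM2r// ler_wpM2r// /K1 lerDl//.
have ld : 'd g x = lL :> (_ -> _).
  apply: diff_unique => //; apply/eqaddoP => e e0.
  by apply: filterS (gE e e0) => h.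
have gd : differentiable g x.
  apply/diff_locallyP; rewrite ld; split=> //; apply/eqaddoP => e e0.
  by apply: filterS (gE e e0) => h.
split=> //; apply/rowP => i; rewrite mxE deriveE// ld /= /l.
rewrite (bigD1 i)//= big1 => [|j ji]; rewrite !mxE ?eqxx/= ?mul1r ?addr0//.
by rewrite (negbTE ji) mul0r.
Unshelve. all: by end_near. Qed.

Lemma grad_comp (g : 'rV[R]_d -> R) (u : R -> R) x (u' : R) :
  differentiable g x -> is_derive (g x) 1 u u' ->
  differentiable (u \o g) x /\ grad (u \o g) x = u' *: grad g x.
Proof.
move=> dg du; have dug : differentiable u (g x) by exact/derivable1_diffP.
have dc : differentiable (u \o g) x by exact: differentiable_comp.
split=> //; apply/rowP => i; rewrite !mxE !deriveE//.
rewrite diff_comp//= deriv1E// derive1E derive_val.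
by rewrite mulrC.
Qed.

Lemma is_derive_line (f : 'rV[R]_d -> R) y v (t : R) :
  differentiable f (t *: v + y) ->
  is_derive t 1 (fun t => f (t *: v + y)) ('D_v f (t *: v + y)).
Proof.
move=> df.
have E : (fun h : R => h^-1 *: (((fun t => f (t *: v + y)) \o shift t) (h *: 1) -
    f (t *: v + y))) =
  (fun h : R => h^-1 *: ((f \o shift (t *: v + y)) (h *: v) - f (t *: v + y))).
  by apply/funext => h /=; rewrite scaler1 scalerDl addrA.
split; first by rewrite /derivable E; exact: diff_derivable.
by rewrite /derive E.
Qed.

(** By the mean value theorem on the segment, the increment is [eta] times the partial derivative at
    an intermediate point, which differs from the one at [y] by at most [L eta]. *)
Lemma partial_taylor (f : 'rV[R]_d -> R) (L : R) y (i : 'I_d) (eta : R) :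
  0 <= L -> L_smooth L f -> 0 < eta ->
  `|f (y + eta *: delta_mx ord0 i) - f y - eta * grad f y ord0 i|
  <= L * eta ^+ 2.
Proof.
move=> L0 [df Lf] eta0; set e := delta_mx ord0 i.
have dl (t : R) : is_derive t 1 (fun t : R => f (t *: e + y)) ('D_e f (t *: e + y)).
  exact: is_derive_line.
have [|c] := @MVT R (fun t : R => f (t *: e + y))
    (fun t => 'D_e f (t *: e + y)) 0 eta eta0 (fun t _ => dl t).
  apply: continuous_subspaceT => t; apply: differentiable_continuous.
  by apply/derivable1_diffP; exact: ex_derive.
rewrite in_itv/= scale0r add0r subr0 => /andP[c0 ceta] fE.
have -> : f (y + eta *: e) - f y - eta * grad f y ord0 i =
    (grad f (c *: e + y) - grad f y) ord0 i * eta.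
  by rewrite [y + _]addrC fE !mxE mulrBl; congr (_ - _); exact: mulrC.
rewrite normrM (gtr0_norm eta0) expr2 mulrA (ler_wpM2r (ltW eta0))//.
apply: (le_trans (enorm_coord_le _ _)); apply: (le_trans (Lf _ _)).
rewrite addrK enormZ enorm_delta mulr1 gtr0_norm// ler_wpM2l// ltW//.
Qed.

Lemma derive_coord (i : 'I_d) x v : 'D_v (fun y : 'rV[R]_d => y ord0 i) x = v ord0 i.
Proof.
rewrite /derive; apply/cvg_lim => //; apply: cvg_near_cst.
near=> h; rewrite /= !mxE addrK scalerA mulVf ?scale1r//.
by near: h; exact: nbhs_dnbhs_neq.
Unshelve. all: by end_near. Qed.

(** Makes coordinates admissible in the Poincaré inequality: a first derivative is constant, and all
    later ones vanish. *)
Lemma smooth_coord (i : 'I_d) : smooth (fun y : 'rV[R]_d => y ord0 i).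
Proof.
have E vs : (vs = [::] :> seq 'rV[R]_d) \/ exists c : R,
    iter_derive vs (fun y : 'rV[R]_d => y ord0 i) = cst c.
  elim: vs => [|v vs [->|[c IH]]]; [by left| |]; right; rewrite /=.
    by exists (v ord0 i); apply/funext => x; exact: derive_coord.
  by exists 0; apply/funext => x; rewrite IH derive_cst.
move=> vs x; have [->|[c ->]] := E vs; last exact: differentiable_cst.
exact: differentiable_coord.
Qed.

Lemma grad_coord (i : 'I_d) x : grad (fun y : 'rV[R]_d => y ord0 i) x = delta_mx ord0 i.
Proof.
by apply/rowP => j; rewrite mxE derive_coord !mxE eqxx/= eq_sym.
Qed.

End calculus.

(** * The measures mu_x *)

Section polynomial_growth.
Context {R : realType} {d : nat}.
Implicit Types (x y : 'rV[R]_d) (g h : 'rV[R]_d -> R) (n : nat).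

(** Measurability is bundled with the bound so that closure under algebraic operations delivers
    integrability at once. The growth is measured from [x], the centre of the Gaussian factor of the
    weight. *)
Definition growth n x h := measurable_fun setT h /\
  exists2 K : R, 0 <= K & forall y, `|h y| <= K * (1 + enorm (x - y)) ^+ n.

Let u_ge1 x y : 1 <= 1 + enorm (x - y). Proof. by rewrite lerDl enorm_ge0. Qed.

Lemma growth_le m n x h : (m <= n)%N -> growth m x h -> growth n x h.
Proof.
move=> mn [mh [K K0 hK]]; split=> //; exists K => // y.
by rewrite (le_trans (hK y))// ler_wpM2l// ler_weXn2l.
Qed.

Lemma growth_cst n x (c : R) : growth n x (cst c).
Proof.
apply: (@growth_le 0%N) => //; split=> //; exists `|c| => // y.
by rewrite expr0 mulr1.
Qed.

Lemma growthM m n x g h :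
  growth m x g -> growth n x h -> growth (m + n) x (fun y => g y * h y).
Proof.
move=> [mg [K K0 gK]] [mh [K' K'0 hK]]; split; first exact: measurable_funM.
exists (K * K'); first exact: mulr_ge0.
by move=> y; rewrite normrM exprD mulrACA ler_pM.
Qed.

Lemma growthD n x g h :
  growth n x g -> growth n x h -> growth n x (fun y => g y + h y).
Proof.
move=> [mg [K K0 gK]] [mh [K' K'0 hK]]; split; first exact: measurable_funD.
exists (K + K'); first exact: addr_ge0.
by move=> y; rewrite mulrDl (le_trans (ler_normD _ _))// lerD.
Qed.

Lemma growthZ n x (c : R) h : growth n x h -> growth n x (fun y => c * h y).
Proof. exact: (growthM _ _ _ _ _ (growth_cst 0 x c)). Qed.

Lemma growthN n x h : growth n x h -> growth n x (fun y => - h y).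
Proof.
by move=> /(growthZ _ _ (-1)); congr growth; apply/funext => y; rewrite mulN1r.
Qed.

Lemma growthB n x g h :
  growth n x g -> growth n x h -> growth n x (fun y => g y - h y).
Proof. by move=> gg /growthN; exact: growthD. Qed.

Lemma growth_sqr x h : growth 1 x h -> growth 2 x (fun y => h y ^+ 2).
Proof. by move=> hh; exact: (growthM 1 1). Qed.

Lemma growth_sum n x (I : Type) (r : seq I) (h : I -> 'rV[R]_d -> R) :
  (forall i, growth n x (h i)) -> growth n x (fun y => \sum_(i <- r) h i y).
Proof.
move=> hh; elim: r => [|i r IH].
  rewrite (_ : (fun _ => _) = cst 0); first exact: growth_cst.
  by apply/funext => y; rewrite big_nil.
rewrite (_ : (fun _ => _) = fun y => h i y + \sum_(j <- r) h j y).
  exact: growthD.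
by apply/funext => y; rewrite big_cons.
Qed.

Lemma growth_coord x (i : 'I_d) : growth 1 x (fun y => y ord0 i).
Proof.
split; first exact: measurable_rV_coord.
exists (1 + enorm x) => [|y]; first by rewrite addr_ge0 ?enorm_ge0.
rewrite expr1 (le_trans (enorm_coord_le _ _))//.
have : enorm y <= enorm x + enorm (x - y).
  rewrite -(enormN (x - y)) {1}(_ : y = x + - (x - y)) ?ler_enormD//.
  by rewrite opprB addrCA subrr addr0.
have := enorm_ge0 x; have := enorm_ge0 (x - y); nra.
Qed.

Lemma lipschitz_enorm_continuous (L : R) g :
  (forall x y, `|g x - g y| <= L * enorm (x - y)) -> continuous g.
Proof.
move=> gL x; have Lx : {for x, continuous (fun y => L * enorm (x - y))}.
  apply: (@continuousM _ _ (cst L) (fun y => enorm (x - y))).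
    exact: cst_continuous.
  apply: (@continuous_comp _ _ _ (fun y => x - y) (@enorm R d)).
    apply: (@continuousB _ _ _ (cst x) idfun); first exact: cst_continuous.
    exact: cvg_id.
  exact: continuous_enorm.
apply/(@cvgrPdist_le R R^o _ (nbhs x)) => e e0.
have /(@cvgrPdist_le R R^o _ (nbhs x))/(_ e e0) := Lx.
apply: filterS => y; rewrite subrr.
rewrite (_ : enorm 0 = 0) ?mulr0 ?sub0r ?normrN; last first.
  by rewrite /enorm big1 ?sqrtr0// => i _; rewrite mxE expr0n.
by apply: le_trans; apply: (le_trans (gL x y)); exact: ler_norm.
Qed.

(** Lipschitz continuity serves twice: it makes the partial derivative continuous, hence measurable,
    and bounds it by [|grad f x| + L |x - y|] coordinatewise. *)
Lemma growth_grad x (L : R) f (i : 'I_d) : 0 <= L -> L_smooth L f ->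
  growth 1 x (fun y => grad f y ord0 i).
Proof.
move=> L0 [_ fL]; split.
  apply: continuous_measurable_rV; apply: (lipschitz_enorm_continuous L) => y z.
  by have := le_trans (enorm_coord_le _ i) (fL y z); rewrite !mxE.
exists (`|grad f x ord0 i| + L) => [|y]; first by rewrite addr_ge0.
rewrite expr1.
have -> : grad f y ord0 i = grad f x ord0 i - (grad f x - grad f y) ord0 i.
  by rewrite !mxE opprB addrCA subrr addr0.
rewrite (le_trans (ler_normB _ _))//.
have := le_trans (enorm_coord_le (grad f x - grad f y) i) (fL x y).
have := enorm_ge0 (x - y); have := normr_ge0 (grad f x ord0 i); nra.
Qed.

End polynomial_growth.

(** * Integration against the unnormalised density of mu_x *)

Section gibbs_measure.
Context {R : realType} {d : nat}.
Variables (mu : {measure set 'rV[R]_d -> \bar R}) (lam del L : R)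
  (f : 'rV[R]_d -> R).
Hypothesis muL : is_lebesgue_measure mu.
Hypotheses (lam0 : 0 < lam) (del0 : 0 < del).
Hypothesis cf : continuous f.
Hypothesis ifin : (\int[mu]_y (expR (- f y / del))%:E < +oo)%E.
Implicit Types (x y : 'rV[R]_d) (g h : 'rV[R]_d -> R).

Let s := lam * del.
Let F y := expR (- f y / del).
Let w x y := mux_weight lam del f x y.

Let s0 : 0 < s. Proof. exact: mulr_gt0. Qed.

(** Separates [F], integrable by (A2), from a Gaussian factor of variance [s] that absorbs the
    growth of integrands. *)
Let wE x y : w x y = F y * expR (- enorm (x - y) ^+ 2 / (2 * s)).
Proof.
rewrite /w /mux_weight /F -expRD; congr expR; rewrite /s; field.
by rewrite !gt_eqF.
Qed.

Let F_ge0 y : 0 <= F y. Proof. exact: expR_ge0. Qed.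

Let measurable_F : measurable_fun setT F.
Proof.
apply: measurableT_comp => //; apply: measurable_funM => //.
by apply: measurableT_comp => //; exact: continuous_measurable_rV.
Qed.

Let measurable_w x : measurable_fun setT (w x).
Proof.
have -> : w x = fun y => F y * expR (- enorm (x - y) ^+ 2 / (2 * s)).
  by apply/funext => y; rewrite wE.
apply: measurable_funM => //; apply: measurableT_comp => //.
apply: measurable_funM => //; apply: measurableT_comp => //.
have -> : (fun y => enorm (x - y) ^+ 2) = (fun y => enorm y ^+ 2) \o (fun y => y + - x).
  by apply/funext => y /=; rewrite -enormN opprB.
apply: measurableT_comp; last exact: measurable_shift.
by apply: continuous_measurable_rV; exact: continuous_sqr_enorm.
Qed.

Let integrable_F : mu.-integrable setT (EFin \o F).
Proof.
apply/integrableP; split; first exact/measurable_EFinP.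
by under eq_integral => y _ do rewrite /= ger0_norm//.
Qed.

Let G_quad x y :
  expR (- enorm (x - y) ^+ 2 / (2 * s)) * (1 + enorm (x - y)) ^+ 2
  <= 4 * expR (2 + 2 * s).
Proof. by apply: gauss_quad_bound => //; exact: enorm_ge0. Qed.

Lemma integrable_growth x g : growth 2 x g ->
  mu.-integrable setT (EFin \o (fun y => w x y * g y)).
Proof.
move=> [mg [K K0 gK]].
apply: (@le_integrable _ _ _ mu _ measurableT _
  (EFin \o (fun y => K * (4 * expR (2 + 2 * s)) * F y))).
- exact/measurable_EFinP/measurable_funM.
- move=> y _; rewrite /= lee_fin.
  rewrite [leRHS]ger0_norm; last by rewrite !mulr_ge0 ?expR_ge0.
  rewrite wE !normrM (ger0_norm (F_ge0 y)) (ger0_norm (expR_ge0 _)).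
  rewrite [leRHS]mulrC -[leLHS]mulrA ler_wpM2l//.
  apply: (le_trans (ler_wpM2l (expR_ge0 _) (gK y))).
  by rewrite mulrCA ler_wpM2l.
- have := integrableZl measurableT (K * (4 * expR (2 + 2 * s))) integrable_F.
  by apply: eq_integrable => // y _ /=; rewrite EFinM.
Qed.

Let I x g := Rintegral mu setT (fun y => w x y * g y).

Let integrable_w x : mu.-integrable setT (EFin \o w x).
Proof.
have := integrable_growth x (cst 1) (growth_cst 2 x 1).
by apply: eq_integrable => // y _; rewrite /= mulr1.
Qed.

Let ID x g h : growth 2 x g -> growth 2 x h ->
  I x (fun y => g y + h y) = I x g + I x h.
Proof.
move=> gg gh; rewrite /I -RintegralD//; try exact: integrable_growth.
by apply: eq_Rintegral => y _; rewrite mulrDr.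
Qed.

Let IZ x (c : R) g : growth 2 x g -> I x (fun y => c * g y) = c * I x g.
Proof.
move=> gg; rewrite /I -RintegralZl//; last exact: integrable_growth.
by apply: eq_Rintegral => y _; rewrite mulrCA.
Qed.

Let Isum x (J : Type) (r : seq J) (g : J -> 'rV[R]_d -> R) :
  (forall j, growth 2 x (g j)) ->
  I x (fun y => \sum_(j <- r) g j y) = \sum_(j <- r) I x (g j).
Proof.
move=> gg; elim: r => [|i r IH].
  rewrite big_nil /I (_ : (fun _ => _) = cst 0) ?Rintegral_cst ?mul0r//.
  by apply/funext => y; rewrite big_nil mulr0.
rewrite big_cons -IH -ID//; last exact: growth_sum.
by congr (I x); apply/funext => y; rewrite big_cons.
Qed.

Let Ile x g h : growth 2 x g -> growth 2 x h -> (forall y, g y <= h y) ->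
  I x g <= I x h.
Proof.
move=> gg gh ghle; apply: le_Rintegral => //; try exact: integrable_growth.
by move=> y _; rewrite ler_wpM2l// expR_ge0.
Qed.

Let Z x := Rintegral mu setT (w x).

(** If the integral vanished, the everywhere positive weight would be zero almost everywhere, making
    the whole space null, whereas the unit cube has measure 1. *)
Let Z_gt0 x : 0 < Z x.
Proof.
rewrite lt_neqAle Rintegral_ge0 ?andbT; last by move=> y _; exact: expR_ge0.
apply/eqP => /esym Z0.
have mw : measurable_fun setT (EFin \o w x) by exact/measurable_EFinP.
have [+ _] := ae_eq_integral_abs mu measurableT mw.
have -> : (\int[mu]_y `|(EFin \o w x) y| = 0)%E.
  under eq_integral => y _ do rewrite gee0_abs ?lee_fin ?expR_ge0//.
  have <- : (Z x)%:E = (\int[mu]_y (w x y)%:E)%E.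
    exact/fineK/(integrable_fin_num measurableT (integrable_w x)).
  by rewrite Z0.
move=> /(_ erefl)[N [mN N0 subN]].
have NT : N = setT.
  rewrite -subTset => y _; apply: subN => /= /(_ Logic.I)[] /eqP.
  by rewrite gt_eqF// expR_gt0.
pose B : set 'rV[R]_d := box 0 (const_mx 1).
have mu1 : mu B = 1%E.
  rewrite muL; last by move=> i; rewrite !mxE.
  by rewrite big1// => i _; rewrite !mxE subr0.
have mB : measurable B.
  by rewrite measurable_rV_box; apply: sub_sigma_algebra; exists 0, (const_mx 1).
have : (mu B <= mu N)%E by rewrite NT le_measure ?inE.
by rewrite N0 mu1 lee_fin ler10.
Qed.

Lemma mux_intE x g : growth 2 x g -> mux_int mu lam del f x g = (Z x)^-1 * I x g.
Proof.
move=> gg; rewrite /I -RintegralZl//; last exact: integrable_growth.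
by apply: eq_Rintegral => y _; rewrite /mux_density mulrAC [LHS]mulrC.
Qed.

Let sum_delta (z : 'rV[R]_d) (c : R) i :
  \sum_(j < d) z ord0 j * (c *: delta_mx ord0 i : 'rV[R]_d) ord0 j = c * z ord0 i.
Proof.
rewrite (bigD1 i)//= big1 => [|j ji]; rewrite !mxE ?eqxx/=.
  by rewrite addr0 mulr1 mulrC.
by rewrite (negbTE ji) !mulr0.
Qed.

Let growth_diff x i : growth 1 x (fun y => x ord0 i - y ord0 i).
Proof. by apply: growthB; [exact: growth_cst|exact: growth_coord]. Qed.

(* With [t] the increment of the logarithm of the weight and [- p] its linear
   part, this is the Taylor remainder of the weight itself. *)
Let weight_remainder c x y eta t p : 0 <= c -> 0 <= eta <= 1 ->
  `|t| <= c * eta * (1 + enorm (x - y)) -> `|t + p| <= c * eta ^+ 2 ->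
  `|w x y * (expR t - 1 + p)|
  <= (4 * expR (2 * c + 2 * s * c ^+ 2) + c) * eta ^+ 2 * F y.
Proof.
move=> c0 eta01 ht hp.
rewrite wE normrM ger0_norm; last by rewrite mulr_ge0// expR_ge0.
rewrite -[leLHS]mulrA [leLHS]mulrC ler_wpM2r//.
by apply: gauss_taylor_bound => //; exact: enorm_ge0.
Qed.

Let Rintegral_remainder (r : 'rV[R]_d -> R) (c : R) :
  mu.-integrable setT (EFin \o r) -> (forall y, `|r y| <= c * F y) ->
  `|Rintegral mu setT r| <= c * Rintegral mu setT F.
Proof.
move=> ir rF; apply: (le_trans (le_normr_Rintegral measurableT ir)).
rewrite -RintegralZl//; apply: le_Rintegral => //.
- exact: (integrable_norm ir).
- by have := integrableZl measurableT c integrable_F; apply: eq_integrable.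
Qed.

(** Moving [x] changes only the Gaussian factor, whose logarithm is quadratic in [h]; no regularity
    of [f] beyond continuity enters. *)
Lemma partition_function_differentiable x : differentiable Z x /\
  grad Z x = \row_i (- s^-1 * I x (fun y => x ord0 i - y ord0 i)).
Proof.
(* The first summand bounds the linear part of the log-increment, the second its quadratic part;
   [weight_remainder] is applied with [eta = enorm h]. *)
pose c := s^-1 + (2 * s)^-1.
have s2 : 0 < 2 * s by exact: mulr_gt0.
have si : 0 <= s^-1 by rewrite invr_ge0 ltW.
have s2i : 0 <= (2 * s)^-1 by rewrite invr_ge0 ltW.
have c0 : 0 <= c by exact: addr_ge0.
apply: (quadratic_remainder_differentiable _ _ _
  ((4 * expR (2 * c + 2 * s * c ^+ 2) + c) * Rintegral mu setT F)) => h h1.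
pose p y := s^-1 * \sum_(i < d) h ord0 i * (x ord0 i - y ord0 i).
have gp : growth 2 x p.
  apply: growthZ; apply: growth_sum => i; apply: growthZ.
  exact: (growth_le 1).
have -> : \sum_(i < d) h ord0 i *
    (\row_i (- s^-1 * I x (fun y => x ord0 i - y ord0 i))) ord0 i = - I x p.
  rewrite /p IZ ?Isum.
  - rewrite mulr_sumr -sumrN; apply: eq_bigr => i _; rewrite mxE IZ; first by ring.
    exact: (growth_le 1).
  - by move=> i; apply: growthZ; exact: (growth_le 1).
  - apply: growth_sum => i; apply: growthZ; exact: (growth_le 1).
have ip := integrable_growth x p gp.
have -> : Z (h + x) - Z x - - I x p =
    Rintegral mu setT (fun y => w (h + x) y - w x y + w x y * p y).
  rewrite RintegralD// ?RintegralB// ?opprK//.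
  by have := integrableB measurableT (integrable_w (h + x)) (integrable_w x);
    apply: eq_integrable.
rewrite mulrAC; apply: Rintegral_remainder.
  have := integrableD measurableT (integrableB measurableT
    (integrable_w (h + x)) (integrable_w x)) ip.
  exact: eq_integrable.
move=> y.
pose t := - (enorm (h + x - y) ^+ 2 - enorm (x - y) ^+ 2) / (2 * s).
have -> : w (h + x) y - w x y + w x y * p y = w x y * (expR t - 1 + p y).
  rewrite (_ : w (h + x) y = w x y * expR t); first by ring.
  by rewrite !wE -mulrA -expRD; congr (_ * expR _); rewrite /t; field; lra.
have tE : t + p y = - enorm h ^+ 2 / (2 * s).
  rewrite /t (_ : h + x - y = (x - y) + h); last by rewrite -addrA addrC.
  rewrite sqr_enormD /p (eq_bigr (fun i => h ord0 i * (x ord0 i - y ord0 i))).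
    by field; lra.
  by move=> i _; rewrite !mxE mulrC.
have tpE : `|t + p y| = (2 * s)^-1 * enorm h ^+ 2.
  by rewrite tE mulNr normrN mulrC ger0_norm// mulr_ge0 ?sqr_ge0.
have tp : `|t + p y| <= c * enorm h ^+ 2.
  by rewrite tpE ler_wpM2r ?sqr_ge0// /c lerDr.
have pb : `|p y| <= s^-1 * (enorm h * enorm (x - y)).
  rewrite normrM (ger0_norm si) ler_wpM2l//.
  apply: le_trans (enorm_cauchy_schwarz h (x - y)).
  rewrite (eq_bigr (fun i => h ord0 i * (x - y) ord0 i))// => i _.
  by rewrite !mxE.
apply: weight_remainder => //; first by rewrite enorm_ge0.
rewrite (_ : t = (t + p y) - p y); last by rewrite addrK.
rewrite (le_trans (ler_normB _ _))//.
have e0 := enorm_ge0 h; have u0 := enorm_ge0 (x - y).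
apply: (@le_trans _ _ ((2 * s)^-1 * enorm h ^+ 2 + s^-1 * (enorm h * enorm (x - y)))).
  by rewrite lerD// tpE.
rewrite (_ : c * enorm h * (1 + enorm (x - y)) =
    (2 * s)^-1 * enorm h + s^-1 * (enorm h * enorm (x - y))
  + (s^-1 * enorm h + (2 * s)^-1 * enorm h * enorm (x - y))); last by rewrite /c; ring.
rewrite -[leLHS]addr0 lerD//; last by rewrite addr_ge0 ?mulr_ge0.
by rewrite lerD2r ler_wpM2l// expr2 ler_piMr.
Qed.

(** * Integration by parts from translation invariance *)

Hypotheses (L0 : 0 <= L) (fL : L_smooth L f).

Let IB x g h : growth 2 x g -> growth 2 x h ->
  I x (fun y => g y - h y) = I x g - I x h.
Proof.
move=> gg gh; rewrite ID//; last exact: growthN.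
congr (_ + _); rewrite -mulN1r -IZ//; congr (I x); apply/funext => y.
by rewrite mulN1r.
Qed.

Let integral_w_shift x v :
  (\int[mu]_y (w x (y + v)%R)%:E = \int[mu]_y (w x y)%:E)%E.
Proof.
apply: (lebesgue_integral_shift mu v (EFin \o w x)) => //.
  exact/measurable_EFinP.
by move=> y; rewrite lee_fin expR_ge0.
Qed.

Let integrable_w_shift x v :
  mu.-integrable setT (EFin \o (fun y => w x (y + v))).
Proof.
apply/integrableP; split.
  apply/measurable_EFinP; apply: (measurableT_comp (measurable_w x)).
  exact: measurable_shift.
under eq_integral => y _ do rewrite /= ger0_norm ?expR_ge0//.
rewrite integral_w_shift.
have /integrableP[_] := integrable_w x.
by under eq_integral => y _ do rewrite /= ger0_norm ?expR_ge0//.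
Qed.

(** Translating by [eta] along axis [i] leaves the integral of the weight unchanged, so its
    first-order term [eta * I x g] is [O(eta^2)], which forces [I x g = 0]. *)
Lemma weight_integration_by_parts x i :
  lam * I x (fun y => grad f y ord0 i) = I x (fun y => x ord0 i - y ord0 i).
Proof.
have gf : growth 1 x (fun y => grad f y ord0 i) by exact: (growth_grad _ L).
have gf2 := growth_le 1 2 _ _ isT gf.
have gd2 := growth_le 1 2 _ _ isT (growth_diff x i).
(* Minus the [i]-th partial derivative of the logarithm of the weight. *)
pose g y := del^-1 * grad f y ord0 i - s^-1 * (x ord0 i - y ord0 i).
have gg : growth 2 x g by apply: growthB; exact: growthZ.
suff : I x g = 0.
  have -> : I x g = del^-1 * I x (fun y => grad f y ord0 i)
      - s^-1 * I x (fun y => x ord0 i - y ord0 i).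
    by rewrite -!IZ//; apply: IB; exact: growthZ.
  move/eqP; rewrite subr_eq0 => /eqP; rewrite /s => E.
  have -> : I x (fun y => x ord0 i - y ord0 i) =
      lam * del * ((lam * del)^-1 * I x (fun y => x ord0 i - y ord0 i)).
    by rewrite mulrA mulfV ?mul1r// gt_eqF// mulr_gt0.
  by rewrite -E -mulrA; congr (_ * _); rewrite mulrA mulfV ?mul1r// gt_eqF.
have si : 0 <= s^-1 by rewrite invr_ge0 ltW.
have di : 0 <= del^-1 by rewrite invr_ge0 ltW.
have s2i : 0 <= (2 * s)^-1 by rewrite invr_ge0 mulr_ge0// ltW.
pose a := `|grad f x ord0 i|.
have a0 : 0 <= a by exact: normr_ge0.
(* The first two summands bound the second-order remainder of the log-weight; the parenthesis bounds
   [g], using [|grad f y| <= a + L u] coordinatewise. *)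
pose c := del^-1 * L + (2 * s)^-1 + (del^-1 * a + del^-1 * L + s^-1).
have c0 : 0 <= c by rewrite !addr_ge0// mulr_ge0.
pose C := (4 * expR (2 * c + 2 * s * c ^+ 2) + c) * Rintegral mu setT F.
have C0 : 0 <= C.
  rewrite mulr_ge0//; last by apply: Rintegral_ge0 => y _; exact: F_ge0.
  by rewrite addr_ge0// mulr_ge0// expR_ge0.
suff key eta : 0 < eta <= 1 -> `|I x g| <= C * eta.
  apply/eqP; rewrite -normr_eq0; apply/negPn/negP => J0.
  have {}J0 : 0 < `|I x g| by rewrite lt_neqAle eq_sym J0 normr_ge0.
  (* With [eta = |I x g| / D <= 1], the bound [key] would give [D <= C], contradicting the choice of
     [D]. *)
  pose D := `|I x g| + C + 1.
  have D0 : 0 < D by rewrite ltr_wpDl// addr_ge0.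
  have := key (`|I x g| / D); rewrite divr_gt0//= ler_pdivrMr// mul1r.
  rewrite {1}/D -addrA lerDl addr_ge0// => /(_ isT).
  rewrite mulrA ler_pdivlMr// mulrC ler_pM2r// /D; lra.
move=> /andP[eta0 eta1]; pose h : 'rV[R]_d := eta *: delta_mx ord0 i.
(* The two zeroth-order terms cancel by translation invariance, leaving only the linear one. *)
have rE : Rintegral mu setT (fun y => w x (y + h) - w x y + eta * (w x y * g y))
    = eta * I x g.
  have ig := integrable_growth x g gg.
  have ieg : mu.-integrable setT (EFin \o (fun y => eta * (w x y * g y))).
    by have := integrableZl measurableT eta ig; apply: eq_integrable.
  rewrite RintegralD ?RintegralB ?RintegralZl//.
    by rewrite /Rintegral integral_w_shift subrr add0r.
  by have := integrableB measurableT (integrable_w_shift x h) (integrable_w x);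
    apply: eq_integrable.
rewrite -(ler_pM2l eta0) -{1}(gtr0_norm eta0) -normrM -rE.
rewrite (_ : eta * (C * eta) =
    ((4 * expR (2 * c + 2 * s * c ^+ 2) + c) * eta ^+ 2) * Rintegral mu setT F);
  last by rewrite /C; ring.
apply: Rintegral_remainder.
  have := integrableD measurableT (integrableB measurableT
    (integrable_w_shift x h) (integrable_w x))
    (integrableZl measurableT eta (integrable_growth x g gg)).
  exact: eq_integrable.
move=> y; set u := enorm (x - y).
have u0 : 0 <= u by exact: enorm_ge0.
pose r := f (y + h) - f y - eta * grad f y ord0 i.
have rL : `|r| <= L * eta ^+ 2 by exact: partial_taylor.
pose t := - (f (y + h) - f y) / del - (enorm (x - (y + h)) ^+ 2 - u ^+ 2) / (2 * s).
have -> : w x (y + h) - w x y + eta * (w x y * g y) =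
    w x y * (expR t - 1 + eta * g y).
  rewrite (_ : w x (y + h) = w x y * expR t); first by ring.
  rewrite !wE /F -!expRD; congr expR; rewrite /t /u.
  by field; rewrite !gt_eqF.
have tE : t + eta * g y = - (del^-1 * r) - (2 * s)^-1 * eta ^+ 2.
  rewrite /t (_ : x - (y + h) = (x - y) + (- eta) *: delta_mx ord0 i); last first.
    by rewrite scaleNr opprD addrA.
  rewrite sqr_enormD sum_delta enormZ enorm_delta mulr1 normrN (gtr0_norm eta0).
  rewrite -/u /r /g !mxE.
  by field; rewrite !gt_eqF.
have tp : `|t + eta * g y| <= (del^-1 * L + (2 * s)^-1) * eta ^+ 2.
  rewrite tE (le_trans (ler_normB _ _))// normrN
    [X in X + _]normrM [X in _ + X]normrM (ger0_norm di).
  rewrite (ger0_norm s2i) (ger0_norm (sqr_ge0 eta)) [leRHS]mulrDl lerD2r -mulrA.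
  by rewrite ler_wpM2l.
have gb : `|grad f y ord0 i| <= a + L * u.
  have -> : grad f y ord0 i = grad f x ord0 i - (grad f x - grad f y) ord0 i.
    by rewrite !mxE opprB addrCA subrr addr0.
  rewrite (le_trans (ler_normB _ _))// lerD2l.
  exact: le_trans (enorm_coord_le _ _) (fL.2 x y).
have xb : `|x ord0 i - y ord0 i| <= u.
  by have := enorm_coord_le (x - y) i; rewrite !mxE.
have pb : `|eta * g y| <= eta * (del^-1 * (a + L * u) + s^-1 * u).
  rewrite normrM (gtr0_norm eta0) ler_pM2l// (le_trans (ler_normB _ _))//.
  by rewrite !normrM (ger0_norm di) (ger0_norm si) lerD// ler_wpM2l.
apply: weight_remainder => //.
- by rewrite ltW.
- rewrite (_ : t = (t + eta * g y) - eta * g y); last by rewrite addrK.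
  rewrite (le_trans (ler_normB _ _))// (le_trans (lerD tp pb))//.
  rewrite -/u /c; set A := del^-1 * L + _.
  have A0 : 0 <= A by rewrite addr_ge0// mulr_ge0.
  (* The last line collects nonnegative surplus terms; what remains follows from [eta^2 <= eta]. *)
  have -> : (A + (del^-1 * a + del^-1 * L + s^-1)) * eta * (1 + u) =
      A * eta + eta * (del^-1 * (a + L * u) + s^-1 * u)
      + (A * eta * u + eta * (del^-1 * a * u + del^-1 * L + s^-1)) by ring.
  rewrite -[leLHS]addr0 lerD//; last first.
    have e0 := ltW eta0; apply: addr_ge0; first by rewrite !mulr_ge0.
    by rewrite mulr_ge0// !addr_ge0// !mulr_ge0.
  by rewrite lerD2r ler_wpM2l// expr2 ler_piMr// ltW.
- apply: (le_trans tp); rewrite ler_wpM2r ?sqr_ge0// /c lerDl.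
  by rewrite !addr_ge0// mulr_ge0.
Qed.

(** * Expectation under mu_x and the gradient estimate *)

Let E x g := (Z x)^-1 * I x g.

Let ED x g h : growth 2 x g -> growth 2 x h ->
  E x (fun y => g y + h y) = E x g + E x h.
Proof. by move=> gg gh; rewrite /E ID// mulrDr. Qed.

Let EZ x (c : R) g : growth 2 x g -> E x (fun y => c * g y) = c * E x g.
Proof. by move=> gg; rewrite /E IZ// mulrCA. Qed.

Let Ecst x (c : R) : E x (cst c) = c.
Proof.
rewrite /E (_ : I x (cst c) = c * Z x); first by rewrite mulrC mulfK// gt_eqF.
rewrite /I /Z -RintegralZl//.
by apply: eq_Rintegral => y _; rewrite mulrC.
Qed.

Let Ele x g h : growth 2 x g -> growth 2 x h -> (forall y, g y <= h y) ->
  E x g <= E x h.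
Proof.
move=> gg gh ghle; apply: ler_wpM2l; last exact: Ile.
by rewrite invr_ge0 ltW.
Qed.

Let Esum x (g : 'I_d -> 'rV[R]_d -> R) :
  (forall j, growth 2 x (g j)) ->
  E x (fun y => \sum_j g j y) = \sum_j E x (g j).
Proof. by move=> gg; rewrite /E Isum// mulr_sumr. Qed.

(** Taking [c = E x g] gives the variance; taking [c] to be a coordinate of [x] gives the
    bias-variance decomposition. *)
Let Esqr_shift x g (c : R) : growth 1 x g ->
  E x (fun y => (c - g y) ^+ 2) = E x (fun y => g y ^+ 2) - 2 * c * E x g + c ^+ 2.
Proof.
move=> gg; have gg2 := growth_le 1 2 _ _ isT gg; have gs := growth_sqr _ _ gg.
rewrite (_ : (fun y => _) = (fun y => g y ^+ 2 + (- (2 * c) * g y + c ^+ 2))).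
  rewrite ED//; last by apply: growthD; [exact: growthZ|exact: growth_cst].
  rewrite ED; [|exact: growthZ|exact: growth_cst].
  by rewrite EZ// Ecst; ring.
by apply/funext => y; ring.
Qed.

(** Jensen's inequality for the square, as nonnegativity of the variance. *)
Let sqr_E_le x g : growth 1 x g -> E x g ^+ 2 <= E x (fun y => g y ^+ 2).
Proof.
move=> gg; have : 0 <= E x (fun y => (E x g - g y) ^+ 2).
  rewrite -(Ecst x 0); apply: Ele; first exact: growth_cst.
    by apply: growth_sqr; apply: growthB => //; exact: growth_cst.
  by move=> y; exact: sqr_ge0.
by rewrite Esqr_shift//; lra.
Qed.

(** The Gaussian normalising constant does not depend on [x], so it drops out when the logarithm is
    differentiated. *)
Let soft_moreauE : soft_moreau mu lam del f =
  (fun z => - del * ln ((2 * pi * s) `^ (- (d%:R / 2)) * z)) \o Z.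
Proof.
apply/funext => x /=; rewrite /soft_moreau; congr (_ * ln _).
rewrite /Z -RintegralZl//; apply: eq_Rintegral => y _.
rewrite /gauss_density [X in _ = _ * X]wE -(enormN (y - x)) opprB -mulrA; congr (_ * _).
by rewrite mulrC.
Qed.

Let is_derive_log_partition (c z : R) : 0 < c -> 0 < z ->
  is_derive z 1 (fun z => - del * ln (c * z)) (- del * z^-1).
Proof.
move=> c0 z0; have cz0 : 0 < c * z by exact: mulr_gt0.
have dln := is_derive1_ln cz0.
have dc : is_derive z 1 (fun z : R => c * z) c.
  by have := is_deriveZ c (is_derive_id z (1 : R)); rewrite [_ *: _]mulr1.
have := is_deriveZ (- del) (is_derive1_comp dln dc).
rewrite [_ *: _](_ : _ = - del * z^-1)//; congr (_ * _).
by field; rewrite !gt_eqF.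
Qed.

Lemma grad_soft_moreau x : differentiable (soft_moreau mu lam del f) x /\
  forall i, lam * grad (soft_moreau mu lam del f) x ord0 i =
    E x (fun y => x ord0 i - y ord0 i).
Proof.
have [dZ gZ] := partition_function_differentiable x.
have pi2s : 0 < 2 * pi * s by rewrite !mulr_gt0// pi_gt0.
have := grad_comp _ _ _ _ dZ (is_derive_log_partition _ _
  (powR_gt0 (- (d%:R / 2)) pi2s) (Z_gt0 x)).
rewrite -soft_moreauE => -[dS ->]; split=> // i.
rewrite gZ !mxE /E /s; field.
by rewrite !gt_eqF.
Qed.

Lemma grad_soft_moreau_approx x (C : R) : mux_poincare mu lam del f x C ->
  enorm (grad (soft_moreau mu lam del f) x - grad f x)
    <= L * lam * enorm (grad (soft_moreau mu lam del f) x)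
       + L * Num.sqrt (d%:R * C).
Proof.
move=> [C0 poincare]; set G := grad _ x.
have gc1 i : growth 1 x (fun y => y ord0 i) by exact: growth_coord.
have gc i : growth 2 x (fun y => y ord0 i ^+ 2) by exact: growth_sqr.
(* Supplies both integrability conditions of the Poincaré inequality for [y_i]: its square grows
   quadratically and its gradient has norm 1. *)
have dens g : growth 2 x g ->
    mu.-integrable setT (EFin \o (fun y => mux_density mu lam del f x y * g y)).
  move=> gg; have := integrableZl measurableT (Z x)^-1 (integrable_growth x g gg).
  apply: eq_integrable => // y _; rewrite /= -EFinM; congr EFin.
  by rewrite /mux_density [LHS]mulrC -mulrA mulrAC mulrA.
have coordE i : E x (fun y => x ord0 i - y ord0 i) = lam * G ord0 i.
  by rewrite (grad_soft_moreau x).2.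
(* Both [lam * G] and [lam * E (grad f y)] equal [x - m] coordinatewise; cancelling [lam] identifies
   them. *)
have GE i : (G - grad f x) ord0 i = E x (fun y => grad f y ord0 i - grad f x ord0 i).
  have gf : growth 1 x (fun y => grad f y ord0 i) by exact: (growth_grad _ L).
  rewrite ED; [|exact: (growth_le 1)|exact: growth_cst].
  rewrite (Ecst x (- grad f x ord0 i)) [LHS]mxE [X in _ + X]mxE; congr (_ - _).
  apply: (mulfI (lt0r_neq0 lam0)).
  by rewrite -coordE /E -weight_integration_by_parts mulrCA.
(* The second moment about [x_i] is the variance, at most [C] by Poincaré, plus
   [(x_i - m_i)^2 = lam^2 G_i^2]. *)
have var i : E x (fun y => (x ord0 i - y ord0 i) ^+ 2) <= C + lam ^+ 2 * G ord0 i ^+ 2.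
  have := poincare (fun y => y ord0 i) (smooth_coord i) (dens _ (gc i)).
  have g1 : (fun y => enorm (grad (fun z : 'rV[R]_d => z ord0 i) y) ^+ 2) = cst 1.
    by apply/funext => y; rewrite grad_coord enorm_delta expr1n.
  have -> : (fun y : 'rV[R]_d => (mux_density mu lam del f x y *
      enorm (grad (fun z : 'rV[R]_d => z ord0 i) y) ^+ 2)%:E) =
      EFin \o (fun y => mux_density mu lam del f x y * cst 1 y).
    by apply/funext => y /=; rewrite grad_coord enorm_delta expr1n.
  rewrite g1 => /(_ (dens _ (growth_cst 2 x 1))).
  have gm : growth 1 x (fun y => y ord0 i) by exact: gc1.
  rewrite !mux_intE; first last.
  - exact: (growth_le 1).
  - apply: growth_sqr; apply: growthB => //; exact: growth_cst.
  - exact: (growth_le 1).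
  - exact: growth_cst.
  rewrite -!/(E x _) Ecst mulr1; set m := E x (fun y => y ord0 i).
  rewrite (_ : (fun y => (y ord0 i - m) ^+ 2) = (fun y => (m - y ord0 i) ^+ 2));
    last by apply/funext => y; rewrite -sqrrN opprB.
  rewrite !Esqr_shift// -/m -exprMn -coordE.
  rewrite (_ : E x (fun y => x ord0 i - y ord0 i) = x ord0 i - m); first by lra.
  rewrite ED; [|exact: growth_cst|by apply: growthN; exact: (growth_le 1)].
  rewrite [X in X + _]Ecst; congr (_ + _).
  rewrite (_ : (fun y => _) = (fun y => -1 * y ord0 i)) ?EZ ?mulN1r//.
    exact: (growth_le 1).
  by apply/funext => y; rewrite mulN1r.
have sq : enorm (G - grad f x) ^+ 2 <= L ^+ 2 * (d%:R * C + lam ^+ 2 * enorm G ^+ 2).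
  have gd i : growth 2 x (fun y => (x ord0 i - y ord0 i) ^+ 2).
    exact/growth_sqr/growth_diff.
  have gdf i : growth 1 x (fun y => grad f y ord0 i - grad f x ord0 i).
    by apply: growthB; [exact: (growth_grad _ L)|exact: growth_cst].
  have gdf2 i := growth_sqr _ _ (gdf i).
  rewrite sqr_enorm.
  apply: (@le_trans _ _ (E x (fun y => L ^+ 2 * \sum_i (x ord0 i - y ord0 i) ^+ 2))).
    apply: (@le_trans _ _ (E x
      (fun y => \sum_i (grad f y ord0 i - grad f x ord0 i) ^+ 2))).
      by rewrite Esum//; apply: ler_sum => i _; rewrite GE; exact: sqr_E_le.
    apply: Ele => [||y].
    - exact: growth_sum.
    - by apply: growthZ; exact: growth_sum.
    have := fL.2 y x.
    rewrite -(@ler_pXn2r _ 2)// ?nnegrE ?mulr_ge0 ?enorm_ge0//.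
    rewrite exprMn -(enormN (y - x)) opprB !sqr_enorm.
    congr (_ <= _ * _); apply: eq_bigr => i _; first by rewrite !mxE.
    by rewrite mxE [X in _ + X]mxE.
  rewrite EZ; last exact: growth_sum.
  rewrite ler_wpM2l ?sqr_ge0// Esum//.
  apply: (@le_trans _ _ (\sum_i (C + lam ^+ 2 * G ord0 i ^+ 2))).
    by apply: ler_sum.
  by rewrite big_split/= sumr_const card_ord -mulr_sumr -sqr_enorm mulr_natl.
have dC : 0 <= d%:R * C by rewrite mulr_ge0// ltW.
set q := Num.sqrt _; have q0 : 0 <= q by exact: sqrtr_ge0.
have qE : q ^+ 2 = d%:R * C by rewrite sqr_sqrtr.
have e0 := enorm_ge0 G; have l0 := ltW lam0.
rewrite -(@ler_pXn2r _ 2)// ?nnegrE ?enorm_ge0 ?addr_ge0 ?mulr_ge0//.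
apply: (le_trans sq); rewrite -qE.
(* Squaring the right-hand side leaves only a nonnegative cross term beyond the bound on the squared
   norm. *)
rewrite (_ : (L * lam * enorm G + L * q) ^+ 2 =
  L ^+ 2 * (q ^+ 2 + lam ^+ 2 * enorm G ^+ 2) + 2 * (L * lam * enorm G * (L * q)));
  last by ring.
by rewrite lerDl !mulr_ge0.
Qed.

End gibbs_measure.

Theorem theorem11 (R : realType) (d : nat)
  (mu : {measure set 'rV[R]_d -> \bar R})
  (lam del L : R) (f : 'rV[R]_d -> R) (CP : 'rV[R]_d -> R) :
  (1 <= d)%N ->
  is_lebesgue_measure mu ->
  0 < lam -> 0 < del ->
  (* (A1) *)
  continuous f -> (exists xs : 'rV[R]_d, forall y, f xs <= f y) ->
  (* (A2) *)
  (\int[mu]_y (expR (- f y / del))%:E < +oo)%E ->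
  L_smooth L f ->
  (forall x, mux_poincare mu lam del f x (CP x)) ->
  (forall x : 'rV[R]_d,
     differentiable (soft_moreau mu lam del f) x /\
     enorm (grad (soft_moreau mu lam del f) x - grad f x)
       <= L * lam * enorm (grad (soft_moreau mu lam del f) x)
          + L * Num.sqrt (d%:R * CP x)) /\
  (forall xk : nat -> 'rV[R]_d,
     (forall k, xk k.+1 = zprox mu lam del f (xk k)) ->
     forall k, enorm (grad f (xk k))
       <= (1 + L * lam) * enorm (grad (soft_moreau mu lam del f) (xk k))
          + L * Num.sqrt (d%:R * CP (xk k))).
Proof.
move=> d1 muL lam0 del0 cf _ ifin fL poincare.
(* Apply the Lipschitz bound to two points at distance 1; [1 <= d] provides the axis that separates
   them. *)
have L0 : 0 <= L.
  have := le_trans (enorm_ge0 _) (fL.2 (delta_mx ord0 (Ordinal d1)) 0).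
  by rewrite subr0 enorm_delta mulr1.
have bound x : enorm (grad (soft_moreau mu lam del f) x - grad f x)
    <= L * lam * enorm (grad (soft_moreau mu lam del f) x)
       + L * Num.sqrt (d%:R * CP x).
  exact: grad_soft_moreau_approx.
split=> [x|xk _ k]; first by split=> //; apply grad_soft_moreau.
set g := grad (soft_moreau _ _ _ _) _.
rewrite (_ : grad f (xk k) = g - (g - grad f (xk k))); last first.
  by rewrite opprB addrCA subrr addr0.
rewrite (le_trans (ler_enormD _ _))// enormN mulrDl mul1r -addrA lerD2l.
exact: bound.
Qed.
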